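(* Consider the asymmetric annihilation process on $L$ sites. Let $\langle\eta_{p_1}\cdots\eta_{p_n}\rangle$ be a correlation function of order $n$, and group the sites $p_1<\dots<p_n$ into blocks of consecutive sites: there are $j$ blocks, the $l$-th block being $\{i_l,i_l+1,\dots,i_l+k_l\}$, of length $k_l+1$ (a block may have size one, i.e. $k_l=0$), with neighbouring blocks separated by at least one site, so that $n=\sum_{l=1}^j(k_l+1)$. Then the steady state equation satisfied by the correlation function of the sites $i_1,\dots,i_1+k_1,\dots,i_j,\dots,i_j+k_j$, where $i_1>1$, is $$n\,\langle\eta_{p_1}\cdots\eta_{p_n}\rangle=\sum_{l=1}^{j}\Bigg\langle\Big(\prod_{m=1}^{l-1}\eta_{i_m}\cdots\eta_{i_m+k_m}\Big)\,\eta_{i_l-1}(1-2\eta_{i_l})\,\eta_{i_l+1}\cdots\eta_{i_l+k_l}\,\Big(\prod_{m=l+1}^{j}\eta_{i_m}\cdots\eta_{i_m+k_m}\Big)\Bigg\rangle .$$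
   Context: The model: a continuous-time Markov chain on configurations $\eta=(\eta_1,\dots,\eta_L)\in\{0,1\}^L$ ($\eta_i=1$ if site $i$ is occupied, $0$ if empty), with parameters $\alpha,\beta>0$ and the following transitions. Bulk: for each pair of neighbouring sites $(i,i+1)$, $1\le i\le L-1$, $10\to 01$ with rate $1$ and $11\to 00$ with rate $1$. Left boundary: at site $1$, $0\to 1$ with rate $\alpha$ and $1\to 0$ with rate $\alpha$. Right boundary: at site $L$, $1\to0$ with rate $\beta$. The bracket $\langle\cdot\rangle$ denotes expectation with respect to the unique stationary distribution (steady state) of this chain. Empty products equal $1$; in particular, when $k_l=0$ the factor $\eta_{i_l+1}\cdots\eta_{i_l+k_l}$ is $1$.
   Formalization: The formal theorem assumes that site L is not among p_1,…,p_n, or that β = 1; otherwise the equation is false, since the particle at L leaves at rate β and the coefficient becomes n−1+β (e.g. L = 2, the single site 2). *)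

(* Defs.v *)
From mathcomp Require Import all_boot all_order all_algebra.

Set Implicit Arguments.
Unset Strict Implicit.
Unset Printing Implicit Defensive.

Import Order.TTheory GRing.Theory Num.Theory.
Local Open Scope ring_scope.

(* Sites are labelled by the natural numbers 1, ..., L; the coordinate of index
   x : 'I_L is the site x.+1. *)
Definition config (L : nat) : finType := {ffun 'I_L -> bool}.

(* False when p is not one of the labels 1, ..., L. *)
Definition occupied (L : nat) (eta : config L) (p : nat) : bool :=
  [exists x : 'I_L, (x.+1 == p) && eta x].

Definition occ (R : realFieldType) (L : nat) (eta : config L) (p : nat) : R :=
  (occupied eta p)%:R.

Definition set_site (L : nat) (eta : config L) (p : nat) (b : bool) : config L :=
  [ffun x : 'I_L => if x.+1 == p then b else eta x].

Definition bulk_rate (R : realFieldType) (L : nat) (eta eta' : config L) : R :=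
  \sum_(1 <= p < L)
    ([&& occupied eta p, ~~ occupied eta p.+1
       & eta' == set_site (set_site eta p false) p.+1 true]%:R
   + [&& occupied eta p, occupied eta p.+1
       & eta' == set_site (set_site eta p false) p.+1 false]%:R).

Definition left_rate (R : realFieldType) (L : nat) (alpha : R)
    (eta eta' : config L) : R :=
  alpha * (~~ occupied eta 1 && (eta' == set_site eta 1 true))%:R
  + alpha * (occupied eta 1 && (eta' == set_site eta 1 false))%:R.

Definition right_rate (R : realFieldType) (L : nat) (beta : R)
    (eta eta' : config L) : R :=
  beta * (occupied eta L && (eta' == set_site eta L false))%:R.

Definition rate (R : realFieldType) (L : nat) (alpha beta : R)
    (eta eta' : config L) : R :=
  bulk_rate R eta eta' + left_rate alpha eta eta' + right_rate beta eta eta'.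

(* Row convention: the entry (eta, eta') is the rate from eta to eta'. *)
Definition generator (R : realFieldType) (L : nat) (alpha beta : R)
    (eta eta' : config L) : R :=
  rate alpha beta eta eta'
  - (eta == eta')%:R * \sum_(zeta : config L) rate alpha beta eta zeta.

Definition is_distribution (R : realFieldType) (L : nat)
    (mu : {ffun config L -> R}) : Prop :=
  (forall eta, 0 <= mu eta) /\ \sum_(eta : config L) mu eta = 1.

Definition is_steady_state (R : realFieldType) (L : nat) (alpha beta : R)
    (mu : {ffun config L -> R}) : Prop :=
  is_distribution mu /\
  forall eta' : config L,
    \sum_(eta : config L) mu eta * generator alpha beta eta eta' = 0.

Definition expect (R : realFieldType) (L : nat) (mu : {ffun config L -> R})
    (f : config L -> R) : R :=
  \sum_(eta : config L) mu eta * f eta.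

Definition block_prod (R : realFieldType) (L : nat) (i k : nat -> nat)
    (eta : config L) (l : nat) : R :=
  \prod_(i l <= q < (i l + k l).+1) occ R eta q.

(* Main.v *)
Require Import Defs.
From mathcomp Require Import all_boot all_order all_algebra.

(* In the steady state the expectation of the generator applied to
   f = \prod_(q in s) eta_q vanishes. A site q of s contributes -f: through the
   bond (q, q+1) when q < L, and through the right boundary, with beta = 1, when
   q = L. A site q+1 of s whose left neighbour is not in s, that is, the first
   site of a block, is flipped at rate eta_q, which replaces its factor by
   eta_q (1 - 2 eta_(q+1)). The left boundary does not act, as 1 is not in s. *)

Set Implicit Arguments.
Unset Strict Implicit.
Unset Printing Implicit Defensive.

Import Order.TTheory GRing.Theory Num.Theory.
Local Open Scope ring_scope.

(** * Single-site updates and sums over sites *)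

Lemma occupied_set_site (L : nat) (eta : config L) (a q : nat) (b : bool) :
  occupied (set_site eta a b) q =
  if q == a then b && (1 <= a <= L)%N else occupied eta q.
Proof.
apply/existsP/idP => [[x /andP[/eqP <-]]|].
  rewrite ffunE; case: eqP => [<- ->|_ etax]; first by rewrite ltn_ord.
  by apply/existsP; exists x; rewrite eqxx.
case: eqP => [->|/eqP neq]; last case/existsP => x /andP[/eqP xq etax].
  case/and3P=> bT a_gt0 a_leL; have xP : (a.-1 < L)%N by rewrite prednK.
  by exists (Ordinal xP); rewrite ffunE /= prednK // eqxx.
by exists x; rewrite ffunE xq eqxx (negPf neq).
Qed.

Lemma sum_andb_eq (R : pzRingType) (T : finType) (b : bool) (z : T)
    (g : T -> R) :
  \sum_(y : T) (b && (y == z))%:R * g y = b%:R * g z.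
Proof.
rewrite (bigD1 z) //= eqxx andbT big1 ?addr0 // => y /negPf ->.
by rewrite andbF mul0r.
Qed.

Lemma sum_nat_mem (V : nmodType) (s : seq nat) (a b : nat) (F : nat -> V) :
  uniq s -> (forall q, q \in s -> (a <= q < b)%N) ->
  \sum_(a <= q < b | q \in s) F q = \sum_(q <- s) F q.
Proof.
move=> s_uniq s_ab; rewrite -big_filter; apply: perm_big.
apply: uniq_perm => // [|q]; first by rewrite filter_uniq ?iota_uniq.
rewrite mem_filter mem_index_iota.
by case: (boolP (q \in s)) => // /s_ab ->.
Qed.

(** For occupied [q], the moves 10 to 01 and 11 to 00 both empty [q] and flip [q.+1]; as both have
    rate 1, one map encodes them. *)
Definition bond_jump (L : nat) (eta : config L) (q : nat) : config L :=
  set_site (set_site eta q false) q.+1 (~~ occupied eta q.+1).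

(** * Action of the generator on products of occupations *)

Section Generator.

Variables (R : realFieldType) (L : nat) (alpha beta : R).
Implicit Types (f : config L -> R) (eta : config L) (s : seq nat).

(** The diagonal of [generator] subtracts the total exit rate times [f eta], which is distributed
    over the targets. In this form, transitions that leave [f] unchanged contribute nothing. *)
Lemma sum_generator f eta :
  \sum_zeta generator alpha beta eta zeta * f zeta =
  \sum_zeta rate alpha beta eta zeta * (f zeta - f eta).
Proof.
rewrite /generator.
under eq_bigr do rewrite mulrBl.
rewrite sumrB; under [RHS]eq_bigr do rewrite mulrBr.
rewrite sumrB -mulr_suml; congr (_ - _).
move: (\sum_zeta rate _ _ _ _) => exit_rate.
rewrite (bigD1 eta) //= eqxx mul1r big1 ?addr0 // => zeta.
by rewrite eq_sym => /negPf ->; rewrite !mul0r.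
Qed.

Lemma steady_state_expect_generator (mu : {ffun config L -> R}) f :
  is_steady_state alpha beta mu ->
  expect mu (fun eta =>
    \sum_zeta rate alpha beta eta zeta * (f zeta - f eta)) = 0.
Proof.
case=> _ mu_stat; rewrite /expect.
under eq_bigr do rewrite -sum_generator mulr_sumr.
rewrite exchange_big big1 // => zeta _.
by under eq_bigr do rewrite mulrA; rewrite -mulr_suml mu_stat mul0r.
Qed.

(** Each event has a single target, and the left boundary flips site 1 at the same rate [alpha] in
    both directions. *)
Lemma sum_rate g eta :
  \sum_zeta rate alpha beta eta zeta * g zeta =
  \sum_(1 <= q < L) occ R eta q * g (bond_jump eta q)
  + alpha * g (set_site eta 1 (~~ occupied eta 1))
  + beta * (occ R eta L * g (set_site eta L false)).
Proof.
rewrite /rate; under eq_bigr do rewrite !mulrDl.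
rewrite !big_split /=; congr (_ + _ + _).
- rewrite /bulk_rate; under eq_bigr do rewrite mulr_suml.
  rewrite exchange_big; apply: eq_bigr => q _.
  under eq_bigr do rewrite mulrDl !andbA.
  rewrite big_split /= !sum_andb_eq /occ /bond_jump.
  case: (occupied eta q); case: (occupied eta q.+1);
    by rewrite /= ?mul0r ?mul1r ?addr0 ?add0r.
- under eq_bigr do rewrite -mulrA.
  under [X in _ + X]eq_bigr do rewrite -mulrA.
  rewrite -!mulr_sumr !sum_andb_eq -mulrDr; congr (_ * _).
  by case: (occupied eta 1); rewrite /= mul0r mul1r ?addr0 ?add0r.
- by under eq_bigr do rewrite -mulrA; rewrite -mulr_sumr sum_andb_eq.
Qed.

Definition occ_prod s eta : R := \prod_(q <- s) occ R eta q.

(** The summand of the steady state equation for a block whose first site is [q]. *)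
Definition occ_source s eta q : R :=
  occ R eta q.-1 * (1 - 2 * occ R eta q) * \prod_(r <- s | r != q) occ R eta r.

Lemma occ_prod_set_site_notin s eta q b :
  q \notin s -> occ_prod s (set_site eta q b) = occ_prod s eta.
Proof.
move=> qNs; apply: eq_big_seq => r rs; rewrite /occ occupied_set_site.
by case: eqP => // rq; rewrite -rq rs in qNs.
Qed.

Lemma occ_prod_eq0 s eta q :
  q \in s -> ~~ occupied eta q -> occ_prod s eta = 0.
Proof.
by move=> qs /negPf qE; rewrite /occ_prod (big_rem q) //= /occ qE mul0r.
Qed.

Lemma occ_mul_occ_prod s eta q :
  q \in s -> occ R eta q * occ_prod s eta = occ_prod s eta.
Proof.
move=> qs; case: (boolP (occupied eta q)) => [qO|qE].
  by rewrite /occ qO mul1r.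
by rewrite (occ_prod_eq0 qs qE) mulr0.
Qed.

(* When [q] is in [s] a jump across the bond always empties [q], whether it
   moves the particle or annihilates a pair, so it kills the product; when only
   [q.+1] is in [s] the jump flips the occupation of [q.+1]. *)
Lemma bond_flow s eta q : uniq s -> (1 <= q < L)%N ->
  occ R eta q * (occ_prod s (bond_jump eta q) - occ_prod s eta) =
  - ((q \in s)%:R * occ_prod s eta)
  + ((q \notin s) && (q.+1 \in s))%:R * occ_source s eta q.+1.
Proof.
move=> s_uniq /andP[q_gt0 q_ltL].
case: (boolP (q \in s)) => [qs|qNs] /=.
  rewrite (@occ_prod_eq0 s (bond_jump eta q) q) //.
    by rewrite sub0r mulrN occ_mul_occ_prod // mul1r mul0r addr0.
  by rewrite !occupied_set_site !eqxx -[_ == _.+1]negbK neq_ltn ltnSn.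
rewrite mul0r oppr0 add0r; case: (boolP (q.+1 \in s)) => [qSs|qSNs]; last first.
  by rewrite !occ_prod_set_site_notin // subrr mulr0 mul0r.
(* Writing [true] outside the lattice has no effect, so the flip takes place only because [q.+1] is
   a site. *)
have qS_site : (1 <= q.+1 <= L)%N by [].
rewrite mul1r /occ_source -mulrA; congr (_ * _).
rewrite /occ_prod !(bigD1_seq q.+1) //=.
rewrite {1}/occ occupied_set_site eqxx qS_site andbT.
have -> : \prod_(r <- s | r != q.+1) occ R (bond_jump eta q) r =
          \prod_(r <- s | r != q.+1) occ R eta r.
  rewrite !(big_seq_cond (fun r => r != _)); apply: eq_bigr => r /andP[rs rq].
  rewrite /occ !occupied_set_site (negPf rq).
  by case: eqP => // rE; rewrite rE (negPf qNs) in rs.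
rewrite -mulrBl /occ; congr (_ * _).
case: (occupied eta q.+1); rewrite /= ?mulr0 // mulr1.
by rewrite -[2]/(1 + 1) opprD addrA subrr.
Qed.

Lemma generator_occ_prod s eta :
  uniq s -> (forall q, q \in s -> (1 < q <= L)%N) -> L \notin s \/ beta = 1 ->
  \sum_zeta rate alpha beta eta zeta * (occ_prod s zeta - occ_prod s eta) =
  - ((size s)%:R * occ_prod s eta)
  + \sum_(q <- s | q.-1 \notin s) occ_source s eta q.
Proof.
move=> s_uniq s_sites s_end.
have s1 : 1%N \notin s by apply/negP => /s_sites.
rewrite (sum_rate (fun zeta => occ_prod s zeta - occ_prod s eta)).
rewrite occ_prod_set_site_notin // subrr mulr0 addr0.
(* Site [L] has no bond to its right; the boundary takes over, and with [beta = 1] it empties [L] at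
   the same unit rate. *)
have -> : beta * (occ R eta L *
            (occ_prod s (set_site eta L false) - occ_prod s eta)) =
          - ((L \in s)%:R * occ_prod s eta).
  case: (boolP (L \in s)) => [Ls|LNs]; last first.
    by rewrite occ_prod_set_site_notin // subrr !mulr0 mul0r oppr0.
  case: s_end => [/negP //|->].
  rewrite (@occ_prod_eq0 s (set_site eta L false) L) //.
    by rewrite sub0r mulrN occ_mul_occ_prod // !mul1r.
  by rewrite occupied_set_site eqxx.
rewrite (eq_big_nat _ _ (fun q => @bond_flow s eta q s_uniq)) big_split /=.
have s_nat q : q \in s -> (1 <= q < L.+1)%N by move=> /s_sites /andP[/ltnW -> ].
have -> : (size s)%:R = \sum_(1 <= q < L) (q \in s)%:R + (L \in s)%:R :> R.
  rewrite -sum1_size natr_sum -(sum_nat_mem _ s_uniq s_nat) big_mkcond /=.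
  (* Splitting off the last index [L] requires [0 < L]; for [L = 0] the ranges are empty and 0 is
     not in [s]. *)
  case: (posnP L) => [L0|L_gt0]; last first.
    by rewrite big_nat_recr //=; congr (_ + _); first apply: eq_bigr => q _;
       case: (_ \in s).
  rewrite !big_geq ?L0 // add0r; case: (boolP (0%N \in s)) => // /s_sites.
  by rewrite ltn0.
rewrite addrAC sumrN -mulr_suml mulrDl opprD; congr (_ + _).
rewrite [RHS]big_mkcond /= -(sum_nat_mem _ s_uniq s_nat) [RHS]big_mkcond /=.
case: (posnP L) => [->|L_gt0]; first by rewrite !big_geq.
(* The left side is indexed by bonds, the right side by their right ends: site 1 drops out and the
   index is shifted by one. *)
rewrite [RHS]big_ltn // (negPf s1) add0r [RHS]big_add1 /=.
apply: eq_bigr => q _.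
by case: (q \in s); case: (q.+1 \in s); rewrite /= ?mul0r ?mul1r.
Qed.

End Generator.

(** * Geometry of separated blocks *)

(** No block ends before it starts, so the gaps between neighbours chain by induction on [l]. *)
Lemma blocks_ordered (j : nat) (i k : nat -> nat) :
  (forall l, (1 <= l < j)%N -> ((i l + k l).+1 < i l.+1)%N) ->
  forall m l, (1 <= m < l)%N -> (l <= j)%N -> ((i m + k m).+1 < i l)%N.
Proof.
move=> sep m l /andP[m_gt0]; elim: l => // l IHl; rewrite ltnS leq_eqVlt.
case/predU1P => [<-|ml] lj; first by apply: sep; rewrite m_gt0.
apply: (ltn_trans (IHl ml (ltnW lj))).
apply: leq_trans (sep l _); last by rewrite lj (leq_trans m_gt0 (ltnW ml)).
by rewrite ltnS leqW ?leq_addr.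
Qed.

Section Blocks.

Variables (j : nat) (i k : nat -> nat).
Hypothesis blocks_separated :
  forall l, (1 <= l < j)%N -> ((i l + k l).+1 < i l.+1)%N.

Let sites := flatten [seq iota (i l) (k l).+1 | l <- iota 1 j].

Lemma mem_block l : (1 <= l < j.+1)%N ->
  forall q, (i l <= q <= i l + k l)%N -> q \in sites.
Proof.
move=> lj q q_l; apply/flatten_mapP; exists l; first by rewrite mem_iota.
by rewrite mem_iota addnS ltnS.
Qed.

Lemma block_start_gt1 l : (1 <= l < j.+1)%N -> (1 < i 1)%N -> (1 < i l)%N.
Proof.
move=> /andP[l_gt0 lj] i1_gt1; case: (ltngtP 1 l) l_gt0 => // [l_gt1 _|<- //].
apply: ltn_trans i1_gt1 (leq_ltn_trans (leq_addr (k 1) _) (ltnW _)).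
exact: (blocks_ordered blocks_separated (m := 1%N) l_gt1 lj).
Qed.

(** The empty site between blocks makes every earlier block end before [(i l).-1], while block [l]
    and the later ones start after it. *)
Lemma pred_block_start_notin l : (1 <= l < j.+1)%N -> (1 < i 1)%N ->
  (i l).-1 \notin sites.
Proof.
move=> l_j i1_gt1; apply/negP => /flatten_mapP[m].
(* Positivity makes [(i l).-1] a true left neighbour: at 0 the predecessor would be 0 again. *)
have il_gt0 := ltnW (block_start_gt1 l_j i1_gt1).
case/andP: l_j => l_gt0 lj.
rewrite !mem_iota add1n ltnS addnS ltnS => /andP[m_gt0 mj] /andP[im mi].
case: (ltngtP m l) => [ml|lm|ml].
- have := @blocks_ordered _ _ _ blocks_separated m l.
  rewrite m_gt0 ml => /(_ isT lj).
  by rewrite -(prednK il_gt0) ltnS ltnNge mi.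
- have := @blocks_ordered _ _ _ blocks_separated l m.
  rewrite l_gt0 lm => /(_ isT mj) /ltnW /(leq_ltn_trans (leq_addr (k l) _)).
  by rewrite ltnNge (leq_trans im (leq_pred _)).
- by move: im; rewrite ml leqNgt prednK ?leqnn.
Qed.

(** Every other site of a block has its predecessor in the same block, so each block contributes
    exactly one term. *)
Lemma sum_block_starts (V : nmodType) (F : nat -> V) : (1 < i 1)%N ->
  \sum_(q <- sites | q.-1 \notin sites) F q = \sum_(1 <= l < j.+1) F (i l).
Proof.
move=> i1_gt1; rewrite big_flatten big_map /index_iota subn1.
apply: eq_big_seq => l; rewrite mem_iota add1n => lj.
rewrite /= big_cons pred_block_start_notin // big_seq_cond big1 ?addr0 // => q.
rewrite mem_iota => /andP[/andP[lq ql] /negP[]]; apply: (mem_block lj).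
have q_gt0 : (0 < q)%N by apply: leq_trans lq.
by rewrite -ltnS prednK // lq -ltnS -addSn (leq_ltn_trans (leq_pred q) ql).
Qed.

(** The blocks are disjoint, so excluding [i l] affects block [l] alone, which loses its first
    factor. *)
Lemma prod_blocks_neq (R : comPzRingType) (F : nat -> R) l :
  (1 <= l < j.+1)%N ->
  \prod_(q <- sites | q != i l) F q =
  (\prod_(1 <= m < l) \prod_(i m <= q < (i m + k m).+1) F q)
  * (\prod_((i l).+1 <= q < (i l + k l).+1) F q)
  * (\prod_(l.+1 <= m < j.+1) \prod_(i m <= q < (i m + k m).+1) F q).
Proof.
move=> /andP[l_gt0 lj].
have index_block m : index_iota (i m) (i m + k m).+1 = iota (i m) (k m).+1.
  by rewrite /index_iota -addnS addKn.
have block_neq m : (1 <= m < j.+1)%N -> m != l ->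
    \prod_(q <- iota (i m) (k m).+1 | q != i l) F q =
    \prod_(i m <= q < (i m + k m).+1) F q.
  move=> /andP[m_gt0 mj] ml; rewrite index_block big_seq_cond [RHS]big_seq.
  apply: eq_bigl => q; rewrite mem_iota addnS ltnS.
  case: (boolP (_ <= q <= _)%N) => //= /andP[mq qm].
  rewrite neq_ltn in ml; rewrite neq_ltn; case/orP: ml => ml.
    by rewrite (leq_ltn_trans qm) // ltnW // (blocks_ordered blocks_separated)
         ?m_gt0.
  rewrite orbC (leq_trans _ mq) //.
  apply: leq_ltn_trans (leq_addr (k l) _) _.
  by rewrite ltnW // (blocks_ordered blocks_separated) ?l_gt0.
rewrite big_flatten big_map.
have -> : iota 1 j = index_iota 1 j.+1 by rewrite /index_iota subn1.
rewrite (big_cat_nat l_gt0) 1?ltnW //= [X in _ * X]big_ltn //= mulrA.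
congr (_ * _ * _).
- apply: eq_big_nat => m /andP[m_gt0 ml].
  by apply: block_neq; rewrite ?m_gt0 ?(ltn_trans ml) // neq_ltn ml.
- rewrite big_cons eqxx /= /index_iota subSS addKn big_seq_cond [RHS]big_seq.
  apply: eq_bigl => q; rewrite mem_iota.
  case: (boolP (_ < q < _)%N) => //= /andP[lq _].
  by rewrite neq_ltn lq orbT.
- apply: eq_big_nat => m /andP[lm mj].
  apply: block_neq; first by rewrite mj (leq_trans _ lm).
  by rewrite neq_ltn lm orbT.
Qed.

End Blocks.

Theorem theorem7 (R : realFieldType) (L : nat) (alpha beta : R)
    (alpha_gt0 : 0 < alpha) (beta_gt0 : 0 < beta)
    (mu : {ffun config L -> R})
    (mu_steady : is_steady_state alpha beta mu)
    (n : nat) (p : n.-tuple nat)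
    (p_sorted : sorted ltn p)
    (p_sites : forall q : nat, q \in p -> (1 <= q <= L)%N)
    (j : nat) (i k : nat -> nat)
    (p_blocks : tval p = flatten [seq iota (i l) (k l).+1 | l <- iota 1 j])
    (blocks_separated :
       forall l : nat, (1 <= l < j)%N -> ((i l + k l).+1 < i l.+1)%N)
    (i1_gt1 : (1 < i 1)%N)
    (right_end : L \notin p \/ beta = 1) :
  n%:R * expect mu (fun eta => \prod_(q <- p) occ R eta q) =
  \sum_(1 <= l < j.+1)
    expect mu (fun eta =>
      (\prod_(1 <= m < l) block_prod R i k eta m)
      * (occ R eta (i l - 1) * (1 - 2 * occ R eta (i l))
         * \prod_((i l).+1 <= q < (i l + k l).+1) occ R eta q)
      * (\prod_(l.+1 <= m < j.+1) block_prod R i k eta m)).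
Proof.
have p_uniq : uniq p := sorted_uniq ltn_trans ltnn p_sorted.
have p_gt1 q : q \in tval p -> (1 < q <= L)%N.
  move=> qp; have /andP[_ ->] := p_sites q qp; rewrite andbT.
  move: qp; rewrite p_blocks => /flatten_mapP[l].
  rewrite !mem_iota add1n ltnS => /andP[l_gt0 lj] /andP[lq _].
  apply: leq_trans lq; apply: (block_start_gt1 blocks_separated) => //.
  by rewrite l_gt0.
have := steady_state_expect_generator (occ_prod R p) mu_steady.
rewrite /expect; under eq_bigr do
  rewrite (generator_occ_prod alpha _ p_uniq p_gt1 right_end) size_tuple
          mulrDr mulrN mulrCA.
rewrite big_split /= sumrN -mulr_sumr => /eqP.
(* Stationarity equates [n] times the correlation with the expected source terms; after this
   substitution only an identity for each configuration [eta] is left. *)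
rewrite addrC subr_eq0 => /eqP <-.
rewrite exchange_big; apply: eq_bigr => eta _.
rewrite -mulr_sumr p_blocks sum_block_starts //; congr (_ * _).
apply: eq_big_nat => l lj.
rewrite /occ_source (prod_blocks_neq blocks_separated _ lj) subn1 /block_prod.
by rewrite !mulrA; congr (_ * _ * _); rewrite -[RHS]mulrA mulrC.
Qed.
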